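(* Let $\Omega\subset\mathbb{R}^2$ be a convex compact set with $0\in\mathrm{int}\,\Omega$, and let $\Omega^\circ$ be its polar set. Then for all $\theta,\theta^\circ\in\mathbb{R}$ the correspondence relation is symmetric: $$\theta\xleftrightarrow{\Omega}\theta^\circ\quad\Longleftrightarrow\quad \theta^\circ\xleftrightarrow{\Omega^\circ}\theta .$$ Moreover, for all $\theta,\theta^\circ\in\mathbb{R}$, $$\theta\xleftrightarrow{\Omega}\theta^\circ\quad\Longleftrightarrow\quad \cos_\Omega\theta\,\cos_{\Omega^\circ}\theta^\circ+\sin_\Omega\theta\,\sin_{\Omega^\circ}\theta^\circ=1 .$$
   Context: Notation. For a convex compact set $\Omega\subset\mathbb{R}^2$ with $0\in\mathrm{int}\,\Omega$, let $\mathbb{S}(\Omega)$ denote its area. Generalized trigonometric functions: for $0\le\theta<2\mathbb{S}(\Omega)$ let $P_\theta\in\partial\Omega$ be the boundary point such that the sector of $\Omega$ swept counterclockwise from the ray $Ox$ (the positive $x$-axis) to the ray $OP_\theta$ has area $\frac12\theta$. Extend $P_\theta$ to all $\theta\in\mathbb{R}$ periodically with period $2\mathbb{S}(\Omega)$. Then $\cos_\Omega\theta$ and $\sin_\Omega\theta$ are by definition the coordinates of $P_\theta$: $P_\theta=(\cos_\Omega\theta,\sin_\Omega\theta)$. The polar set is $\Omega^\circ=\{(p,q)\in\mathbb{R}^2: px+qy\le 1\text{ for all }(x,y)\in\Omega\}$; it is again convex and compact with $0\in\mathrm{int}\,\Omega^\circ$, so $\cos_{\Omega^\circ},\sin_{\Omega^\circ}$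 are defined by the same construction; write $Q_\psi=(\cos_{\Omega^\circ}\psi,\sin_{\Omega^\circ}\psi)\in\partial\Omega^\circ$ for $\psi\in\mathbb{R}$. Correspondence: $\theta\xleftrightarrow{\Omega}\theta^\circ$ means that the covector $Q_{\theta^\circ}$ determines a supporting half-plane of $\Omega$ at $P_\theta$, i.e. $\langle Q_{\theta^\circ},P_\theta\rangle=\max_{P\in\Omega}\langle Q_{\theta^\circ},P\rangle$, where $\langle\cdot,\cdot\rangle$ is the standard pairing. The relation $\xleftrightarrow{\Omega^\circ}$ is defined in the same way with $\Omega$ replaced by $\Omega^\circ$ (and $\Omega^\circ$ replaced by $\Omega^{\circ\circ}=\Omega$). *)

(* Defs.v *)
From HB Require Import structures.
From mathcomp Require Export all_boot all_order all_algebra.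
From mathcomp Require Export all_classical all_reals all_analysis.
Export Order.TTheory GRing.Theory Num.Theory.
Export numFieldNormedType.Exports.

Set Implicit Arguments.
Unset Strict Implicit.
Unset Printing Implicit Defensive.

Local Open Scope classical_set_scope.
Local Open Scope ring_scope.

Section GeneralizedTrigonometry.
Context {R : realType}.
Implicit Types (Omega : set (R * R)) (P Q : R * R) (alpha theta psi : R).

Definition plane_measure : set (R * R) -> \bar R :=
  (@lebesgue_measure R \x @lebesgue_measure R)%E.

Definition area Omega : R := fine (plane_measure Omega).

Definition boundary Omega : set (R * R) := closure Omega `\` interior Omega.

Definition pairing Q P : R := Q.1 * P.1 + Q.2 * P.2.

Definition polar Omega : set (R * R) :=
  [set Q | forall P, Omega P -> pairing Q P <= 1].

Definition ray alpha : set (R * R) :=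
  [set P | exists2 r, 0 <= r & P = (r * cos alpha, r * sin alpha)].

Definition sector Omega alpha : set (R * R) :=
  Omega `&` \bigcup_(beta in `[0, alpha]) ray beta.

(* [P] is the boundary point in a direction [alpha] of [0, 2 pi[ such that the
   sector swept counterclockwise from the positive x-axis to the direction of
   [P] has area [theta / 2]. *)
Definition is_trig_point Omega theta P : Prop :=
  boundary Omega P /\
  exists alpha, [/\ 0 <= alpha < pi *+ 2, ray alpha P
    & area (sector Omega alpha) = theta / 2].

(* Representative of [theta] modulo the period [2 * area Omega] in
   [0, 2 * area Omega[ *)
Definition trig_reduce Omega theta : R :=
  theta - (Num.floor (theta / (2 * area Omega)))%:~R * (2 * area Omega).

(* [is_trig_point] determines exactly one point when [Omega] is a convex
   compact neighbourhood of 0; the default value (0, 0) of [xget] is only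
   relevant for other sets. *)
Definition trig_point Omega theta : R * R :=
  xget (0, 0) [set P | is_trig_point Omega (trig_reduce Omega theta) P].

Definition gcos Omega theta : R := (trig_point Omega theta).1.
Definition gsin Omega theta : R := (trig_point Omega theta).2.

Definition is_max (A : set R) (m : R) : Prop := A m /\ ubound A m.

Definition corresponds Omega theta psi : Prop :=
  let P := (gcos Omega theta, gsin Omega theta) in
  let Q := (gcos (polar Omega) psi, gsin (polar Omega) psi) in
  is_max [set pairing Q P' | P' in Omega] (pairing Q P).

End GeneralizedTrigonometry.

(* Main.v *)
Require Import Defs.
From mathcomp Require Import lra ring.
Local Open Scope classical_set_scope.
Local Open Scope ring_scope.

(** The correspondence says that [Q] attains its maximum over [Omega] at [P],
    where [P] and [Q] are the trigonometric points of [Omega] and of its polar.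
    Such a [Q] lies on the boundary of the polar set, and this forces its
    maximum over [Omega] to be exactly 1: it is at most 1 because [Q] is in the
    polar set, and if it were less than 1 then, [Omega] being bounded, every
    covector near [Q] would still be in the polar set, so that [Q] would be
    interior ([polar_boundary_attained]).  Hence the correspondence amounts to
    [pairing Q P = 1] ([correspondsE]), which is the second claim.  This
    equation is symmetric in [P] and [Q], and [Omega] is the polar of its polar
    ([bipolar]), which gives the first claim.

    The argument needs [P] to be a point of [Omega] and [Q] a boundary point of
    the polar set, that is, the point with a prescribed swept area has to exist
    ([trig_point_boundary]).  The swept area increases with the angle, from 0 to
    the area of [Omega].  It does not jump from the right because the sectors
    of angles [a + 1 / n] shrink to the sector of angle [a], and it does not
    jump from the left because the sectors of angles [a - 1 / n] exhaust it up
    to its last ray, which is a null set.  So every intermediate value is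
    attained ([ex_sector_measure]), and the farthest point of [Omega] on the
    ray of the angle found is a boundary point ([ex_boundary_ray]).  All the
    sets involved are compact, hence Borel, and a Borel set of the plane is
    measurable for the product of the Borel sigma-algebras of the two axes
    ([open_measurable_plane]). *)

Set Implicit Arguments.
Unset Strict Implicit.
Unset Printing Implicit Defensive.

Section PolarCorrespondence.
Context {R : realType}.
Local Notation plane := (measurableTypeR R * measurableTypeR R)%type.
Implicit Types (Omega : set (R * R)) (P Q : R * R).

(** * Compact sets and Lebesgue measure in the plane *)

Lemma ball_planeE P Q (e : R) :
  ball P e Q <-> `|P.1 - Q.1| < e /\ `|P.2 - Q.2| < e.
Proof. by []. Qed.

(** An open set is the union of the rational boxes that it contains, and there
    are only countably many of them. *)
Lemma open_measurable_plane (U : set (R * R)) :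
  open U -> measurable (U : set plane).
Proof.
move=> oU.
pose box (q : (rat * rat) * (rat * rat)) : set plane :=
  `]ratr q.1.1, ratr q.1.2[ `*` `]ratr q.2.1, ratr q.2.2[.
pose F q := if `[< box q `<=` U >] then box q else set0.
have -> : (U : set plane) = \bigcup_q F q.
  apply/seteqP; split => [P UP|P [q _]]; last first.
    by rewrite /F; case: asboolP => // qU; exact: qU.
  have /nbhs_ballP[e /= e0 eU] : nbhs P U by apply: open_nbhs_nbhs; split.
  have approx (x : R) : exists a b : rat, [/\ x - e < ratr a, ratr a < x,
      x < ratr b & ratr b < x + e].
    have [a] := @rat_in_itvoo R (x - e) x ltac:(by rewrite ltrBlDr ltrDl).
    rewrite in_itv/= => /andP[a1 a2].
    have [b] := @rat_in_itvoo R x (x + e) ltac:(by rewrite ltrDl).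
    by rewrite in_itv/= => /andP[b1 b2]; exists a, b.
  have [a [b [a1 a2 b1 b2]]] := approx P.1.
  have [c [d [c1 c2 d1 d2]]] := approx P.2.
  exists ((a, b), (c, d)) => //; rewrite /F asboolT.
    by split; rewrite /= in_itv/= ?a2 ?c2.
  move=> Q [] /=; rewrite !in_itv/= => /andP[? ?] /andP[? ?].
  by apply: eU; apply/ball_planeE; rewrite !ltr_norml; split; lra.
apply: countable_bigcupT_measurable => // q; rewrite /F.
by case: asboolP => _ //; apply: measurableX; exact: measurable_itv.
Qed.

Lemma compact_measurable_plane (K : set (R * R)) :
  compact K -> measurable (K : set plane).
Proof.
move=> cK; rewrite -[K]setCK; apply: measurableC; apply: open_measurable_plane.
by apply: closed_openC; apply: compact_closed cK; exact: norm_hausdorff.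
Qed.

Lemma compact_plane_bounded (K : set (R * R)) : compact K ->
  exists2 M : R, 0 < M & forall P, K P -> `|P.1| <= M /\ `|P.2| <= M.
Proof.
move=> /compact_bounded [M [_ /(_ (Num.max M 0 + 1))] bM].
exists (Num.max M 0 + 1); first by rewrite ltr_wpDl// le_max lexx orbT.
have M1 : M < Num.max M 0 + 1.
  by rewrite (le_lt_trans (y := Num.max M 0)) ?ltrDl// le_max lexx.
by move=> P KP; have := bM M1 P KP; rewrite /= prod_normE ge_max => /andP.
Qed.

Lemma plane_measureX (A B : set (measurableTypeR R)) :
  measurable A -> measurable B ->
  plane_measure (A `*` B) = (lebesgue_measure A * lebesgue_measure B)%E.
Proof. exact: product_measure1E. Qed.

Lemma compact_plane_measure_lty (K : set (R * R)) :
  compact K -> (plane_measure K < +oo)%E.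
Proof.
move=> cK; have [M M0 KM] := compact_plane_bounded cK.
pose I : set (measurableTypeR R) := `[- M, M]%classic.
have mI : measurable I by exact: measurable_itv.
apply: (@le_lt_trans _ _ (plane_measure (I `*` I))).
  apply: le_measure; rewrite ?inE.
  - exact: compact_measurable_plane.
  - exact: measurableX.
  - by move=> P /KM[]; rewrite !ler_norml => ? ?; split.
rewrite plane_measureX// /I lebesgue_measure_itv/=.
by case: ifP => _; rewrite -?EFinN -?EFinD -?EFinM ?ltry// mule0 ltry.
Qed.

Lemma nbhs0_plane_measure_gt0 (K : set (R * R)) :
  measurable (K : set plane) -> interior K (0, 0) -> (0 < plane_measure K)%E.
Proof.
move=> mK /nbhs_ballP[e /= e0 eK].
pose I : set (measurableTypeR R) := `]- e, e[%classic.
have mI : measurable I by exact: measurable_itv.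
apply: (@lt_le_trans _ _ (plane_measure (I `*` I))).
  rewrite plane_measureX// /I lebesgue_measure_itv/= lte_fin.
  by rewrite gtrN// -?EFinN -?EFinD -?EFinM lte_fin mulr_gt0// opprK addr_gt0.
apply: le_measure; rewrite ?inE//; first exact: measurableX.
move=> [x y] [/= xI yI]; apply: eK; apply/ball_planeE.
rewrite /= !sub0r !normrN !ltr_norml.
by have := conj xI yI.
Qed.

(** The vertical sections of a line through the origin are at most singletons,
    except for the vertical line, which is a product of the null set [{0}] with
    the second axis. *)
Lemma line_plane_measure0 (c s : R) (A : set (R * R)) :
  c ^+ 2 + s ^+ 2 = 1 -> measurable (A : set plane) ->
  (forall P, A P -> P.1 * s = P.2 * c) -> plane_measure A = 0%E.
Proof.
move=> cs mA AL; have [c0|c0] := eqVneq c 0.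
  have s0 : s != 0.
    by apply/eqP => s0; move: cs; rewrite c0 s0; lra.
  apply/eqP; rewrite -measure_le0.
  have m0 : measurable ([set 0] : set (measurableTypeR R)) by [].
  apply: (@le_trans _ _ (plane_measure ([set 0] `*` setT))).
    apply: le_measure; rewrite ?inE//; first exact: measurableX.
    move=> P /AL; rewrite c0 mulr0 => /eqP; rewrite mulf_eq0 (negbTE s0) orbF.
    by move=> /eqP.
  by rewrite plane_measureX// lebesgue_measure_set1 mul0e.
apply: integral0_eq => x _ /=; apply/eqP; rewrite -measure_le0.
apply: (@le_trans _ _ (lebesgue_measure [set (x * s) / c])).
  apply: le_measure; rewrite ?inE//; first exact: measurable_xsection.
  by move=> y; rewrite /xsection/= inE => /AL /= ->; rewrite mulfK.
by rewrite lebesgue_measure_set1.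
Qed.

(** * The pairing of the plane *)

Lemma pairingC P Q : pairing P Q = pairing Q P.
Proof. by rewrite /pairing mulrC [P.2 * _]mulrC. Qed.

Lemma continuous_pairing Q : continuous (pairing Q).
Proof.
move=> P; apply: cvgD; apply: cvgM;
  first [exact: cvg_cst|exact: cvg_fst|exact: cvg_snd].
Qed.

(** * Rays and sectors *)

Lemma ray_radius_sqr alpha (r : R) P :
  P = (r * cos alpha, r * sin alpha) -> r ^+ 2 = P.1 ^+ 2 + P.2 ^+ 2.
Proof. by move=> ->; rewrite /= !exprMn -mulrDr cos2Dsin2 mulr1. Qed.

Lemma ray_normE alpha P :
  ray alpha P <-> P = (Num.sqrt (P.1 ^+ 2 + P.2 ^+ 2) * cos alpha,
                       Num.sqrt (P.1 ^+ 2 + P.2 ^+ 2) * sin alpha).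
Proof.
split=> [[r r0 eP]|->]; last by exists (Num.sqrt (P.1 ^+ 2 + P.2 ^+ 2)).
by rewrite -(ray_radius_sqr eP) sqrtr_sqr ger0_norm.
Qed.

(** Polar coordinates exist: the angle is the arc cosine of [x / r], reflected
    to [[pi, 2 pi]] for points of the lower half-plane. *)
Lemma ex_ray P : exists2 alpha, 0 <= alpha <= pi *+ 2 & ray alpha P.
Proof.
case: P => x y; pose r := Num.sqrt (x ^+ 2 + y ^+ 2).
have r2 : r ^+ 2 = x ^+ 2 + y ^+ 2 by rewrite sqr_sqrtr// addr_ge0// sqr_ge0.
have [r0|r0] := eqVneq r 0.
  exists 0; first by rewrite lexx mulrn_wge0// pi_ge0.
  exists 0 => //; move: r2; rewrite r0 expr0n/= => /esym/eqP.
  rewrite paddr_eq0 ?sqr_ge0// !sqrf_eq0 => /andP[/eqP -> /eqP ->].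
  by rewrite !mul0r.
have rp : 0 < r by rewrite lt_def r0 sqrtr_ge0.
have xr : -1 <= x / r <= 1.
  rewrite ler_pdivrMr// ler_pdivlMr// mulN1r mul1r -ler_norml.
  rewrite -(ger0_norm (ltW rp)) -ler_sqr ?nnegrE// !real_normK ?num_real//.
  by rewrite r2 lerDl sqr_ge0.
have [a0 ca] := acos_def xr; have sa := sin_acos xr.
have {}sa : r * sin (acos (x / r)) = `|y|.
  have y2 : 1 - (x / r) ^+ 2 = (y / r) ^+ 2.
    by rewrite !expr_div_n -[y ^+ 2](addKr (x ^+ 2)) -r2; field.
  by rewrite sa y2 sqrtr_sqr normf_div (gtr0_norm rp) mulrCA divff// mulr1.
have {}ca : r * cos (acos (x / r)) = x by rewrite ca mulrCA divff// mulr1.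
have [y0|y0] := leP 0 y.
  exists (acos (x / r)).
    by case/andP: a0 => -> /= a1; rewrite (le_trans a1)// mulr2n lerDl pi_ge0.
  by exists r; [exact: ltW|rewrite sa ca ger0_norm].
exists (pi *+ 2 - acos (x / r)).
  case/andP: a0 => a0 a1; rewrite subr_ge0 lerBlDr lerDl a0 andbT.
  by rewrite (le_trans a1)// mulr2n lerDl pi_ge0.
exists r; first exact: ltW.
rewrite cosB sinB cos2pi sin2pi !(mul0r, mul1r, addr0, sub0r).
by rewrite mulrN sa ca ltr0_norm// opprK.
Qed.

(** The rays of angles in [[a, b]], cut at a radius that [Omega] does not
    exceed, form the image of a rectangle under polar coordinates. *)
Lemma compact_arc_sector Omega (a b : R) : compact Omega ->
  compact (Omega `&` \bigcup_(beta in `[a, b]) ray beta).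
Proof.
move=> cO; have [M M0 OM] := compact_plane_bounded cO.
pose polar_map (q : R * R) : R * R := (q.1 * cos q.2, q.1 * sin q.2).
have pc : continuous polar_map.
  move=> q; apply: (@cvg_pair _ _ _ (nbhs q) (nbhs (q.1 * cos q.2))
    (nbhs (q.1 * sin q.2))); apply: cvgM; (try exact: cvg_fst).
    by apply: continuous_comp; [exact: cvg_snd|exact: continuous_cos].
  by apply: continuous_comp; [exact: cvg_snd|exact: continuous_sin].
(* [2 * M] bounds the Euclidean norm of a point with coordinates at most [M]. *)
pose W := polar_map @` (`[0, 2 * M] `*` `[a, b]).
have cW : compact W.
  apply: continuous_compact; first exact: continuous_subspaceT.
  by apply: compact_setX; exact: segment_compact.
have -> : Omega `&` \bigcup_(beta in `[a, b]) ray beta = W `&` Omega.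
  apply/seteqP; split =>
      [P [OP [t tab [r r0 eP]]]|_ [[[r t]] /= [+ tab]] <- OP].
    split => //; exists (r, t) => //; split => //=.
    have [Px Py] := OM _ OP; have r2 := ray_radius_sqr eP.
    rewrite in_itv/= r0/= leNgt; apply/negP => Mr.
    move: Px Py; rewrite !ler_norml => /andP[? ?] /andP[? ?]; nra.
  by rewrite in_itv/= => /andP[r0 _]; split => //; exists t => //; exists r.
apply: compact_closedI => //.
by apply: compact_closed cO; exact: norm_hausdorff.
Qed.

Lemma compact_ray Omega (a : R) : compact Omega -> compact (Omega `&` ray a).
Proof.
move=> cO; have := compact_arc_sector (a := a) (b := a) cO.
by rewrite set_itv1 bigcup_set1.
Qed.

(** The farthest point of [Omega] on a ray cannot be interior, since it could
    be pushed outwards. *)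
Lemma ex_boundary_ray Omega alpha : compact Omega -> interior Omega (0, 0) ->
  exists2 P, boundary Omega P & ray alpha P.
Proof.
move=> cO O0; pose u : R * R := (cos alpha, sin alpha).
have uE r : pairing u (r * cos alpha, r * sin alpha) = r.
  by rewrite /pairing/= mulrCA [sin _ * _]mulrCA -mulrDr -!expr2 cos2Dsin2 mulr1.
have [||P] := @compact_EVT_max _ R (pairing u) _ _ (compact_ray (a := alpha) cO).
- exists (0, 0); split; first exact: interior_subset O0.
  by exists 0 => //; rewrite !mul0r.
- by apply: continuous_subspaceT; exact: continuous_pairing.
rewrite inE => -[OP [r r0 eP]] maxP; exists P; last by exists r.
split; first exact: subset_closure.
move=> /nbhs_ballP[e /= e0 eO].
have [h h0 he] : exists2 h, 0 < h & h < e by exists (e / 2); lra.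
have := maxP ((r + h) * cos alpha, (r + h) * sin alpha).
rewrite inE eP !uE => /(_ _)/Wrap[]; last by rewrite gerDl leNgt h0.
split; last by exists (r + h) => //; rewrite addr_ge0// ltW.
apply: eO; apply/ball_planeE.
rewrite eP /= !mulrDl !opprD !addrA !subrr !sub0r !normrN !normrM.
by rewrite (gtr0_norm h0); split; apply: (le_lt_trans _ he);
  rewrite ler_piMr ?cos_max ?sin_max ?(ltW h0).
Qed.

(** * The area swept by a sector *)

Lemma sector_le Omega a b : a <= b -> sector Omega a `<=` sector Omega b.
Proof.
move=> ab P [OP [t]]; rewrite /= in_itv/= => /andP[t0 ta] tP.
by split => //; exists t => //; rewrite /= in_itv/= t0 (le_trans ta).
Qed.

Lemma sector_full Omega : sector Omega (pi *+ 2) = Omega.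
Proof.
apply/seteqP; split=> [P []//|P OP]; split => //.
by have [a a2 aP] := ex_ray P; exists a.
Qed.

Lemma measurable_sector Omega a : compact Omega ->
  measurable (sector Omega a : set plane).
Proof.
by move=> cO; exact: compact_measurable_plane (compact_arc_sector cO).
Qed.

Lemma plane_measure_ray Omega a : compact Omega ->
  plane_measure (Omega `&` ray a) = 0%E.
Proof.
move=> cO; apply: (@line_plane_measure0 (cos a) (sin a)).
- exact: cos2Dsin2.
- exact: compact_measurable_plane (compact_ray cO).
- by move=> P [_ [r _ ->]] /=; ring.
Qed.

(** A point of all the larger sectors that is not in the sector of angle [a]
    has angles [t n] with [a < t n <= a + 1 / (n + 1)].  They all give the same
    point, so by continuity of the sine and cosine their limit [a] is an angle
    of the point too. *)
Lemma sector_bigcap Omega a :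
  \bigcap_n sector Omega (a + n.+1%:R^-1) = sector Omega a.
Proof.
apply/seteqP; split=> [P aP|P aP n _]; last first.
  by apply: sector_le aP; rewrite lerDl.
split; first by have [] := aP 0%N I.
have [[t tn tP]|nP] := pselect (exists2 t : R, 0 <= t <= a & ray t P).
  by exists t.
have tP n : {t : R | 0 <= t <= a + n.+1%:R^-1 & ray t P}.
  by apply: cid2; have [_ [t]] := aP n I; rewrite /= in_itv/= => ? ?; exists t.
pose t n : R := s2val (tP n).
have ta : t @ \oo --> a.
  apply: (@squeeze_cvgr _ _ _ _ (fun=> a) (fun n => a + n.+1%:R^-1)).
  - apply: nearW => n; rewrite {}/t; case: (tP n) => /= b /andP[b0 bn] bP.
    rewrite bn andbT leNgt; apply/negP => ba; apply: nP; exists b => //.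
    by rewrite b0 ltW.
  - exact: cvg_cst.
  - rewrite -[X in _ --> X]addr0; apply: cvgD; first exact: cvg_cst.
    exact: cvg_harmonic.
have a0 : 0 <= a.
  rewrite -(cvg_lim _ ta)//; apply: limr_ge; first by apply/cvg_ex; exists a.
  by apply: nearW => n; rewrite /t; case: (tP n) => /= b /andP[].
exists a; first by rewrite /= in_itv/= lexx a0.
apply/ray_normE; rewrite {1}[P]surjective_pairing.
set r := Num.sqrt _.
have rP n : P.1 = r * cos (t n) /\ P.2 = r * sin (t n).
  rewrite /t; case: (tP n) => /= b _ /ray_normE; rewrite -/r => bP.
  by split; rewrite {1}bP.
have lim_eq (f : R -> R) (x : R) :
    continuous f -> (forall n, x = r * f (t n)) -> x = r * f a.
  move=> fc xE; apply: (@cvg_unique R _ (r * f (t n) @[n --> \oo]) _ x).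
  - exact: norm_hausdorff.
  - have <- : cst x = (fun n => r * f (t n)) by apply/funext => n /=; exact: xE.
    exact: cvg_cst.
  - by apply: cvgM; [exact: cvg_cst|apply: cvg_comp ta _; exact: fc].
congr pair; apply: lim_eq.
- exact: continuous_cos.
- by move=> n; case: (rP n).
- exact: continuous_sin.
- by move=> n; case: (rP n).
Qed.

Lemma sector_sub_bigcupU_ray Omega a :
  sector Omega a `<=`
  \bigcup_n sector Omega (a - n.+1%:R^-1) `|` Omega `&` ray a.
Proof.
move=> P [OP [t]]; rewrite /= in_itv/= => /andP[t0].
rewrite le_eqVlt => /predU1P[ta|tlt] tP; first by right; rewrite -ta.
left; have [n nt] := ltr_add_invr tlt.
exists n => //; split => //; exists t => //.
by rewrite /= in_itv/= t0 lerBrDr ltW.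
Qed.

(** The angle is the supremum of those whose sector has measure at most [m];
    the measure of its sector is at most [m] by continuity from the left, and
    at least [m] by continuity from the right. *)
Lemma ex_sector_measure Omega (m : \bar R) : compact Omega ->
  (0 <= m < plane_measure Omega)%E ->
  exists2 a, 0 <= a < pi *+ 2 & plane_measure (sector Omega a) = m.
Proof.
move=> cO /andP[m0 mO].
have mS a := measurable_sector a cO.
have mR a : measurable (Omega `&` ray a : set plane).
  exact: compact_measurable_plane (compact_ray cO).
have muS a b : a <= b ->
    (plane_measure (sector Omega a) <= plane_measure (sector Omega b))%E.
  by move=> ab; apply: le_measure; rewrite ?inE//; exact: sector_le.
pose A :=
  [set a | 0 <= a <= pi *+ 2 /\ (plane_measure (sector Omega a) <= m)%E].
have A0 : A 0.
  split; first by rewrite lexx mulrn_wge0// pi_ge0.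
  have -> : sector Omega 0 = Omega `&` ray 0.
    by rewrite /sector set_itv1 bigcup_set1.
  by rewrite plane_measure_ray.
have supA : has_sup A.
  by split; [exists 0|exists (pi *+ 2) => x [/andP[]]].
pose s := sup A.
have s0 : 0 <= s by apply: sup_upper_bound.
have s2pi : s <= pi *+ 2 by apply: ge_sup; [exists 0|move=> x [/andP[]]].
have sm : (plane_measure (sector Omega s) <= m)%E.
  pose U : set plane := \bigcup_n sector Omega (s - n.+1%:R^-1).
  have mU : measurable U by apply: bigcupT_measurable => n.
  have Um : (plane_measure U <= m)%E.
    apply: (@cvge_le _ \oo _ R
      (fun n => plane_measure (sector Omega (s - n.+1%:R^-1)))); last first.
      apply: nondecreasing_cvg_mu => // i j ij; apply/subsetPset/sector_le.
      by rewrite lerB// lef_pV2 ?posrE// ler_nat.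
    apply: nearW => n.
    have [//|x [_ xm] /ltW xs] := @sup_adherent R A n.+1%:R^-1 _ supA.
    exact: le_trans (muS _ _ xs) xm.
  apply: (@le_trans _ _ (plane_measure (U `|` Omega `&` ray s))).
    apply: le_measure; rewrite ?inE//; first exact: measurableU.
    exact: sector_sub_bigcupU_ray.
  apply: le_trans (measureU2 _ mU (mR s)) _.
  by rewrite [X in (_ + X <= _)%E](plane_measure_ray s cO) adde0.
have slt : s < pi *+ 2.
  rewrite lt_neqAle s2pi andbT; apply/eqP => s2.
  by move: sm; rewrite s2 sector_full leNgt mO.
exists s; first by rewrite s0.
apply/le_anti; rewrite sm /= -(sector_bigcap Omega s).
apply: (@cvge_ge _ \oo _ R
  (fun n => plane_measure (sector Omega (s + n.+1%:R^-1)))); last first.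
  apply: nonincreasing_cvg_mu => //.
  - apply: le_lt_trans (compact_plane_measure_lty cO).
    apply: le_measure; rewrite ?inE//; first exact: compact_measurable_plane.
    by move=> P [].
  - by rewrite sector_bigcap.
  - move=> i j ij; apply/subsetPset/sector_le.
    by rewrite lerD2l lef_pV2 ?posrE// ler_nat.
have [n0 n0s] := ltr_add_invr slt.
near=> n; have sn : s + n.+1%:R^-1 <= pi *+ 2.
  rewrite (le_trans _ (ltW n0s))// lerD2l lef_pV2 ?posrE// ler_nat ltnS.
  by near: n; exact: nbhs_infty_ge.
rewrite leNgt; apply/negP => /ltW nm.
have : A (s + n.+1%:R^-1) by split => //; rewrite sn addr_ge0.
by move=> /(sup_upper_bound supA); rewrite gerDl leNgt invr_gt0 ltr0n.
Unshelve. all: by end_near. Qed.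

Lemma trig_reduce_itv Omega theta : 0 < area Omega ->
  0 <= trig_reduce Omega theta < 2 * area Omega.
Proof.
move=> S0; have S20 : 0 < 2 * area Omega by rewrite mulr_gt0.
have /andP[f1 f2] := floor_itv (theta / (2 * area Omega)).
rewrite /trig_reduce subr_ge0 -ler_pdivlMr// f1 /= ltrBlDl.
by move: f2; rewrite ltr_pdivrMr// intrD mulrDl mul1r.
Qed.

(** A point with the prescribed swept area exists, so that [trig_point] never
    takes its default value. *)
Lemma trig_point_boundary Omega theta : compact Omega ->
  interior Omega (0, 0) -> boundary Omega (trig_point Omega theta).
Proof.
move=> cO O0; have mO := compact_measurable_plane cO.
have muO : plane_measure Omega = (area Omega)%:E.
  by rewrite /area fineK// ge0_fin_numE ?compact_plane_measure_lty.
have S0 : 0 < area Omega by rewrite -lte_fin -muO nbhs0_plane_measure_gt0.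
have /andP[t0 tS] := trig_reduce_itv theta S0.
have [|a a2 aE] :=
    @ex_sector_measure Omega (trig_reduce Omega theta / 2)%:E cO.
  by rewrite muO !lee_fin lte_fin divr_ge0//= ltr_pdivrMr// mulrC.
have [P bP aP] := ex_boundary_ray a cO O0.
suff [] : is_trig_point Omega (trig_reduce Omega theta) (trig_point Omega theta)
  by [].
apply: (@xgetI _ _ _ P); split => //; exists a; split => //.
by rewrite /area aE.
Qed.

(** * Polar sets *)

Lemma convex_segment Omega P Q (t : R) : convex_set Omega -> 0 <= t <= 1 ->
  Omega P -> Omega Q ->
  Omega (t * P.1 + (1 - t) * Q.1, t * P.2 + (1 - t) * Q.2).
Proof.
move=> cvx /andP[t0 t1] OP OQ.
have ti : Itv.spec (@Itv.num_sem R) (Itv.Real `[0%Z, 1%Z]) t.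
  by rewrite /= /Itv.num_sem /= num_real in_itv /= t0 t1.
by have /= := cvx P Q (Itv.mk ti); rewrite !inE => /(_ OP OQ).
Qed.

(** Testing a covector of the polar set on the four points [(h, 0)], [(-h, 0)],
    [(0, h)] and [(0, -h)] of [Omega] bounds its coordinates by [1 / h]. *)
Lemma polar_bound Omega : interior Omega (0, 0) ->
  exists2 M : R, 0 < M & forall Q, polar Omega Q -> `|Q.1| <= M /\ `|Q.2| <= M.
Proof.
move=> /nbhs_ballP[e /= e0 eO].
have [h h0 he] : exists2 h : R, 0 < h & h < e by exists (e / 2); lra.
have OP x y : `|x| <= h -> `|y| <= h -> Omega (x, y).
  move=> xh yh; apply: eO; apply/ball_planeE; rewrite /= !sub0r !normrN.
  by split; exact: le_lt_trans he.
exists h^-1; first by rewrite invr_gt0.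
move=> Q pQ; have bnd x y : `|x| <= h -> `|y| <= h -> Q.1 * x + Q.2 * y <= 1.
  by move=> xh yh; exact: pQ (OP _ _ xh yh).
have hh : `|h| <= h by rewrite gtr0_norm.
have hn : `|- h| <= h by rewrite normrN.
have h00 : `|0 : R| <= h by rewrite normr0 ltW.
rewrite -[h^-1]mul1r !ler_pdivlMr// -(gtr0_norm h0) -!normrM !ler_norml.
have := bnd h 0 hh h00; have := bnd (- h) 0 hn h00.
have := bnd 0 h h00 hh; have := bnd 0 (- h) h00 hn.
by split; lra.
Qed.

Lemma compact_polar Omega : interior Omega (0, 0) -> compact (polar Omega).
Proof.
move=> O0; have [M M0 bM] := polar_bound O0.
have -> : polar Omega = (`[- M, M] `*` `[- M, M]) `&` polar Omega.
  apply/seteqP; split=> [Q pQ|Q []//]; split => //.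
  by have [] := bM _ pQ; rewrite !ler_norml; split.
apply: compact_closedI.
  by apply: compact_setX; exact: segment_compact.
have -> : polar Omega =
    \bigcap_(P in Omega) (pairing P @^-1` [set x | x <= 1]).
  by apply/seteqP; split => Q pQ P OP; rewrite /= pairingC; exact: pQ.
apply: closed_bigI => P _; apply: closed_comp; last exact: closed_le.
by move=> Q _; exact: continuous_pairing.
Qed.

Lemma polar_interior0 Omega : compact Omega -> interior (polar Omega) (0, 0).
Proof.
move=> cO; have [M M0 bM] := compact_plane_bounded cO.
have M2 : 0 < (2 * M)^-1 by rewrite invr_gt0 mulr_gt0.
apply/nbhs_ballP; exists (2 * M)^-1 => //= Q /ball_planeE[/=].
rewrite !sub0r !normrN => /ltW Q1 /ltW Q2 P /bM[P1 P2]; rewrite /pairing.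
have bnd x y : `|x| <= (2 * M)^-1 -> `|y| <= M -> x * y <= 2^-1.
  move=> xM yM; apply: le_trans (ler_norm _) _; rewrite normrM.
  apply: (le_trans (ler_pM _ _ xM yM)) => //.
  by rewrite invfM -mulrA mulVf ?mulr1// gt_eqF.
have := bnd _ _ Q1 P1; have := bnd _ _ Q2 P2; lra.
Qed.

(** A point [P] of the bipolar set coincides with its nearest point [X] in
    [Omega]: otherwise [Q = P - X] is maximal over [Omega] at [X], the maximum
    is positive as 0 is interior, and [Q] divided by this maximum is in the
    polar set although its pairing with [P] exceeds 1. *)
Lemma bipolar Omega : convex_set Omega -> compact Omega ->
  interior Omega (0, 0) -> polar (polar Omega) = Omega.
Proof.
move=> cvx cO O0; apply/seteqP; split => [P ppP|P OP Q pQ]; last first.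
  by rewrite pairingC; exact: pQ.
pose dist (X : R * R) := (P.1 - X.1) ^+ 2 + (P.2 - X.2) ^+ 2.
have distc : continuous dist.
  by move=> X; apply: cvgD; apply: cvgM; apply: cvgB;
    first [exact: cvg_cst|exact: cvg_fst|exact: cvg_snd].
have OO : Omega (0, 0) by exact: interior_subset O0.
have [||X] := @compact_EVT_min _ R dist Omega _ cO.
- by exists (0, 0).
- exact: continuous_subspaceT.
rewrite inE => OX minX.
pose Q : R * R := (P.1 - X.1, P.2 - X.2).
have supp Y : Omega Y -> pairing Q Y <= pairing Q X.
  move=> OY; rewrite leNgt; apply/negP => lt.
  pose d := pairing Q Y - pairing Q X.
  pose n := (Y.1 - X.1) ^+ 2 + (Y.2 - X.2) ^+ 2.
  have d0 : 0 < d by rewrite subr_gt0.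
  have n0 : 0 <= n by rewrite addr_ge0// sqr_ge0.
  have dn : 0 < d + n by rewrite ltr_pwDl.
  (* Moving from [X] towards [Y] by the fraction [t] changes the squared
     distance to [P] by [t ^ 2 * n - 2 * t * d], and this [t] in [[0, 1]] is
     small enough to make it negative. *)
  pose t := d / (d + n).
  have t0 : 0 < t by rewrite divr_gt0.
  have t01 : 0 <= t <= 1 by rewrite ltW//= ler_pdivrMr// mul1r lerDl.
  have tn : t * (d + n) = d by rewrite divfK// gt_eqF.
  have := minX _ (mem_set (convex_segment cvx t01 OY OX)).
  have -> : dist (t * Y.1 + (1 - t) * X.1, t * Y.2 + (1 - t) * X.2) =
     dist X - t * (2 * d - t * n) by rewrite /dist /d /n /pairing /=; ring.
  rewrite lerBrDr gerDl leNgt => /negP; apply; apply: mulr_gt0 => //.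
  have : 0 < t * d by exact: mulr_gt0.
  by lra.
have [Q0|Q0] := eqVneq (pairing Q Q) 0.
  suff -> : P = X by [].
  move/eqP: Q0; rewrite paddr_eq0 -?expr2 ?sqr_ge0// !sqrf_eq0 !subr_eq0.
  move=> /andP[/eqP P1 /eqP P2].
  by rewrite [P]surjective_pairing P1 P2 -surjective_pairing.
have QQ : 0 < pairing Q Q by rewrite lt_def Q0 addr_ge0// -expr2 sqr_ge0.
have c0 : 0 < pairing Q X.
  have /nbhs_ballP[e /= e0 eO] := O0.
  pose k := 1 + `|Q.1| + `|Q.2|.
  have k0 : 0 < k by rewrite /k -addrA ltr_pwDl// addr_ge0.
  (* The scale [h] puts [h * Q] in the ball of radius [e] around 0. *)
  have [h h0 hk] : exists2 h, 0 < h & h * k = e.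
    by exists (e / k); [rewrite divr_gt0|rewrite divfK// gt_eqF].
  apply: (@lt_le_trans _ _ (pairing Q (h * Q.1, h * Q.2))).
    have -> : pairing Q (h * Q.1, h * Q.2) = h * pairing Q Q.
      by rewrite /pairing /=; ring.
    by rewrite mulr_gt0.
  apply: supp; apply: eO; apply/ball_planeE; rewrite /= !sub0r !normrN !normrM.
  rewrite -hk (gtr0_norm h0) !ltr_pM2l//.
  have := normr_ge0 Q.1; have := normr_ge0 Q.2; rewrite /k.
  by split; lra.
pose Q' : R * R := (Q.1 / pairing Q X, Q.2 / pairing Q X).
have Q'E Y : pairing Q' Y = pairing Q Y / pairing Q X.
  by rewrite /pairing /Q' /=; ring.
have /ppP : polar Omega Q' by move=> Y OY; rewrite Q'E ler_pdivrMr// mul1r supp.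
rewrite pairingC Q'E ler_pdivrMr// mul1r leNgt => /negP; case.
by rewrite -subr_gt0 (_ : _ - _ = pairing Q Q)// /pairing /Q /=; ring.
Qed.

(** * Corresponding points *)

(** If the maximum of [Q] over [Omega] were less than 1, a perturbation of the
    coordinates of [Q] by at most [d] would change each of the two terms of the
    pairing by at most half the gap, so that [Q] would be interior. *)
Lemma polar_boundary_attained Omega Q : compact Omega -> Omega !=set0 ->
  boundary (polar Omega) Q -> exists2 P, Omega P & 1 <= pairing Q P.
Proof.
move=> cO Oneq [_ niQ].
have [P /set_mem OP maxP] := compact_EVT_max Oneq cO
  (continuous_subspaceT (continuous_pairing (Q := Q))).
exists P => //; rewrite leNgt; apply/negP => lt1; apply: niQ.
have [M M0 bM] := compact_plane_bounded cO.
pose d := (1 - pairing Q P) / (2 * M).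
have d0 : 0 < d by rewrite divr_gt0 ?subr_gt0// mulr_gt0.
have dM : d * M = (1 - pairing Q P) / 2.
  by rewrite /d invfM mulrA mulfVK// gt_eqF.
apply/nbhs_ballP; exists d => //= Q' /ball_planeE[/ltW Q1 /ltW Q2] Y OY.
have bnd x y : `|x| <= d -> `|y| <= M -> - (x * y) <= d * M.
  move=> xd yM; apply: le_trans (ler_norm _) _; rewrite normrN normrM.
  exact: ler_pM.
have [Y1 Y2] := bM _ OY; have QY := maxP _ (mem_set OY).
have := bnd _ _ Q1 Y1; have := bnd _ _ Q2 Y2; move: QY dM.
by rewrite /pairing; lra.
Qed.

Lemma is_max_pairingE Omega P Q : compact Omega -> Omega P -> polar Omega Q ->
  boundary (polar Omega) Q ->
  is_max [set pairing Q P' | P' in Omega] (pairing Q P) <-> pairing Q P = 1.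
Proof.
move=> cO OP pQ bQ; split=> [[_ maxP]|PQ1]; last first.
  by rewrite PQ1; split=> [|_ [P' /pQ ? <-]//]; exists P.
have [P' OP' P'1] := polar_boundary_attained cO (ex_intro _ _ OP) bQ.
by apply/le_anti; rewrite pQ//= (le_trans P'1)//; apply: maxP; exists P'.
Qed.

Lemma correspondsE Omega theta psi : compact Omega ->
  interior Omega (0, 0) ->
  corresponds Omega theta psi <->
  pairing (trig_point (polar Omega) psi) (trig_point Omega theta) = 1.
Proof.
move=> cO O0; have cp := compact_polar O0.
have bP := trig_point_boundary theta cO O0.
have bQ := trig_point_boundary psi cp (polar_interior0 cO).
have hd := @norm_hausdorff R (R * R)%type.
rewrite /corresponds /gcos /gsin.
move: (trig_point Omega theta) (trig_point (polar Omega) psi) bP bQ.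
move=> [x y] [p q] bP bQ; apply: is_max_pairingE => //.
- by apply: (compact_closed hd cO); case: bP.
- by apply: (compact_closed hd cp); case: bQ.
Qed.

End PolarCorrespondence.

Theorem theorem1 (R : realType) (Omega : set (R * R))
    (Omega_convex : convex_set Omega)
    (Omega_compact : compact Omega)
    (Omega_int0 : interior Omega (0, 0)) :
  (forall theta theta' : R,
     corresponds Omega theta theta' <->
     corresponds (polar Omega) theta' theta) /\
  (forall theta theta' : R,
     corresponds Omega theta theta' <->
     gcos Omega theta * gcos (polar Omega) theta' +
       gsin Omega theta * gsin (polar Omega) theta' = 1).
Proof.
have cE := correspondsE _ _ Omega_compact Omega_int0.
have cpE := correspondsE _ _ (compact_polar Omega_int0)
  (polar_interior0 Omega_compact).
rewrite (bipolar Omega_convex Omega_compact Omega_int0) in cpE.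
split=> theta theta'; apply: iff_trans (cE theta theta') _; rewrite pairingC.
  exact: iff_sym (cpE theta' theta).
exact: iff_refl.
Qed.
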